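(* Suppose that Assumption B (stated in the context) holds for the QCQP $(\mathcal{P})$. If all off-diagonal elements of every matrix $Q^0,\dots,Q^m$ are nonpositive, then the SDP relaxation of $(\mathcal{P})$ is exact.
   Context: Let $\mathbb{S}^n$ be the space of real symmetric $n\times n$ matrices, $[m]=\{1,\dots,m\}$, and $A\bullet B=\sum_{i,j}A_{ij}B_{ij}$. Let $Q^0,\dots,Q^m\in\mathbb{S}^n$ and $b\in\mathbb{R}^m$. Consider the QCQP $(\mathcal{P})$: minimize $x^TQ^0x$ over $x\in\mathbb{R}^n$ subject to $x^TQ^px\le b_p$ for $p\in[m]$. Throughout, $(\mathcal{P})$ is assumed to be feasible. Its SDP relaxation $(\mathcal{P}_R)$ is: minimize $Q^0\bullet X$ over $X\in\mathbb{S}^n$ subject to $Q^p\bullet X\le b_p$ for $p\in[m]$, $X\succeq O$ (positive semidefinite). The dual $(\mathcal{D}_R)$ is: maximize $-b^Ty$ over $y\in\mathbb{R}^m$ subject to $y\ge 0$ and $S(y):=Q^0+\sum_{p=1}^m y_pQ^p\succeq O$. The SDP relaxation is called exact if $(\mathcal{P}_R)$ has an optimal solution of rank at most $1$. Assumption B: (i) the sets of optimal solutions of $(\mathcal{P}_R)$ and of $(\mathcal{D}_R)$ are both nonempty; and (ii) at least one of the following holds: (a) the feasible set of $(\mathcal{P}_R)$ is bounded; or (b) for $(\mathcal{D}_R)$, the set of optimal solutions is bounded and the interior of the feasible set is nonempty, in the sense that there is a feasible $\bar y$ with $S(\bar y)\succ O$ (positive definite). *)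

(* Defs.v *)
From mathcomp Require Import all_boot all_order all_algebra.
From mathcomp Require Import sesquilinear.
From mathcomp Require Import all_classical all_reals all_analysis.

Set Implicit Arguments.
Unset Strict Implicit.
Unset Printing Implicit Defensive.

Import Order.TTheory GRing.Theory Num.Theory.
Import numFieldNormedType.Exports.

Local Open Scope classical_set_scope.
Local Open Scope ring_scope.

Section Matrices.
Variables (R : realType) (n : nat).
Implicit Types A B : 'M[R]_n.

Definition qform A (x : 'cV[R]_n) : R := (x^T *m A *m x) ord0 ord0.

Definition frob A B : R := \sum_(i < n) \sum_(j < n) A i j * B i j.

Definition possemidef A : Prop :=
  A \is symmetricmx /\ forall x : 'cV[R]_n, 0 <= qform A x.

Definition posdef A : Prop :=
  A \is symmetricmx /\ forall x : 'cV[R]_n, x != 0 -> 0 < qform A x.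

End Matrices.

Section Optimization.
Variables (R : realType) (T : Type).

Definition minimizers (D : set T) (f : T -> R) : set T :=
  [set x | D x /\ forall z, D z -> f x <= f z].

Definition maximizers (D : set T) (f : T -> R) : set T :=
  [set x | D x /\ forall z, D z -> f z <= f x].

End Optimization.

(* The QCQP  min x^T Q0 x  s.t.  x^T (Q p) x <= b_p, where p : 'I_m stands for
   the constraint index p.+1 of [m]. *)
Section QCQP.
Variables (R : realType) (n m : nat).
Variables (Q0 : 'M[R]_n) (Q : 'I_m -> 'M[R]_n) (b : 'cV[R]_m).

Definition qcqp_feasible : set 'cV[R]_n :=
  [set x : 'cV[R]_n | forall p : 'I_m, qform (Q p) x <= b p ord0].

(* X ranges over symmetric matrices: possemidef includes symmetry. *)
Definition sdp_feasible : set 'M[R]_n :=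
  [set X : 'M[R]_n | (forall p : 'I_m, frob (Q p) X <= b p ord0) /\ possemidef X].

Definition sdp_optimal : set 'M[R]_n := minimizers sdp_feasible (frob Q0).

Definition slack (y : 'cV[R]_m) : 'M[R]_n :=
  Q0 + \sum_(p < m) y p ord0 *: Q p.

Definition dual_feasible : set 'cV[R]_m :=
  [set y : 'cV[R]_m | (forall p : 'I_m, 0 <= y p ord0) /\ possemidef (slack y)].

Definition dual_objective (y : 'cV[R]_m) : R :=
  - \sum_(p < m) b p ord0 * y p ord0.

Definition dual_optimal : set 'cV[R]_m :=
  maximizers dual_feasible dual_objective.

Definition assumptionB : Prop :=
  (sdp_optimal !=set0 /\ dual_optimal !=set0) /\
  (bounded_set sdp_feasible \/
   (bounded_set dual_optimal /\
    exists2 y, dual_feasible y & posdef (slack y))).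

Definition sdp_exact : Prop :=
  exists2 X, sdp_optimal X & (\rank X <= 1)%N.

End QCQP.

(* Main.v *)
(** If [X] is positive semidefinite then [X i j <= sqrt (X i i) * sqrt (X j j)],
    so the rank-one matrix [v v^T] with [v i = sqrt (X i i)] has the same
    diagonal as [X] and dominates it entrywise.  Replacing [X] by [v v^T]
    therefore does not increase the inner product with any matrix whose
    off-diagonal entries are nonpositive: feasibility and optimality are kept. *)
Require Import Defs.
From mathcomp Require Import all_boot all_order all_algebra.
From mathcomp Require Import sesquilinear.
From mathcomp Require Import all_classical all_reals all_analysis.
From mathcomp Require Import ring lra.

Set Implicit Arguments.
Unset Strict Implicit.
Unset Printing Implicit Defensive.

Import Order.TTheory GRing.Theory Num.Theory.

Local Open Scope classical_set_scope.
Local Open Scope ring_scope.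

(** Restricts the form to a coordinate plane, so that semidefiniteness becomes an inequality in two
    scalars. *)
Lemma qform_delta2 (R : realType) (n : nat) (A : 'M[R]_n) (i j : 'I_n)
    (s t : R) :
  qform A (s *: delta_mx i 0 + t *: delta_mx j 0) =
  s ^+ 2 * A i i + s * t * (A i j + A j i) + t ^+ 2 * A j j.
Proof.
have entry (k l : 'I_n) :
    ((delta_mx k 0 : 'cV[R]_n)^T *m A *m (delta_mx l 0 : 'cV[R]_n)) ord0 ord0 =
    A k l.
  by rewrite trmx_delta -rowE -colE !mxE.
rewrite /qform [(_ + _)^T]raddfD /= !linearZ /= !mulmxDl !mulmxDr -!scalemxAl -!scalemxAr.
rewrite ![fun_of_matrix (_ + _) _ _]mxE ![fun_of_matrix (_ *: _) _ _]mxE.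
rewrite !entry.
ring.
Qed.

Lemma symmetricmxP (R : realType) (n : nat) (A : 'M[R]_n) :
  reflect (A^T = A) (A \is symmetricmx).
Proof.
rewrite is_hermitianmxE expr0 scale1r map_mx_id// eq_sym.
exact: eqP.
Qed.

Lemma possemidef_diag_ge0 (R : realType) (n : nat) (A : 'M[R]_n) (i : 'I_n) :
  possemidef A -> 0 <= A i i.
Proof.
case=> _ /(_ (1 *: delta_mx i 0 + 0 *: delta_mx i 0)).
by rewrite qform_delta2 expr1n expr0n /= mulr0 !mul0r !addr0 mul1r.
Qed.

(** A binary quadratic form that is nonnegative for all [s], [t] has nonpositive discriminant;
    suitable [s] and [t] show it directly. *)
Lemma possemidef_minor2 (R : realType) (n : nat) (A : 'M[R]_n) (i j : 'I_n) :
  possemidef A -> A i j ^+ 2 <= A i i * A j j.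
Proof.
move=> psdA.
have ai := possemidef_diag_ge0 i psdA.
have aj := possemidef_diag_ge0 j psdA.
have q_ge0 s t : 0 <= s ^+ 2 * A i i + s * t * (A i j + A i j) + t ^+ 2 * A j j.
  have [symA /(_ (s *: delta_mx i 0 + t *: delta_mx j 0))] := psdA.
  by rewrite qform_delta2 -[in A j i](symmetricmxP _ symA) [A^T _ _]mxE.
have [ai0|ai_neq0] := eqVneq (A i i) 0.
  (* With [A i i = 0] the form at this point equals [- (A j j + 2) * A i j ^+ 2], which forces
     [A i j = 0]. *)
  have := q_ge0 (- (A j j + 1)) (A i j); rewrite ai0 => q.
  have := sqr_ge0 (A i j) => c2.
  have : 0 <= A i j ^+ 2 * A j j by exact: mulr_ge0.
  nra.
have ai_gt0 : 0 < A i i by rewrite lt_def ai_neq0.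
rewrite -(ler_pM2l ai_gt0) -subr_ge0.
(* This point minimizes the form in [s] for [t = A i i]; the value there is
   [A i i * (A i i * A j j - A i j ^+ 2)]. *)
have := q_ge0 (- A i j) (A i i).
by congr (0 <= _); ring.
Qed.

Lemma possemidef_le_sqrt_diag (R : realType) (n : nat) (A : 'M[R]_n)
    (i j : 'I_n) :
  possemidef A -> A i j <= Num.sqrt (A i i) * Num.sqrt (A j j).
Proof.
move=> psdA; rewrite -sqrtrM ?possemidef_diag_ge0//.
apply: le_trans (ler_norm _) _.
by rewrite -sqrtr_sqr ler_wsqrtr// possemidef_minor2.
Qed.

Lemma possemidef_outer (R : realType) (n : nat) (v : 'cV[R]_n) :
  possemidef (v *m v^T).
Proof.
split=> [|x].
  by apply/symmetricmxP; rewrite trmx_mul trmxK.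
rewrite /qform mulmxA -[_ *m v^T *m x]mulmxA.
have -> : v^T *m x = (x^T *m v)^T by rewrite trmx_mul trmxK.
by rewrite mxE big_ord1 [(_^T) _ _]mxE -expr2 sqr_ge0.
Qed.

Lemma frob_sqrt_diag_le (R : realType) (n : nat) (A X : 'M[R]_n) :
  (forall i j : 'I_n, i != j -> A i j <= 0) -> possemidef X ->
  let v := \col_i Num.sqrt (X i i) in frob A (v *m v^T) <= frob A X.
Proof.
move=> offdiagA psdX /=; apply: ler_sum => i _; apply: ler_sum => j _.
rewrite !mxE big_ord1 !mxE.
(* The sign of [A i i] is unknown, so the diagonal terms must agree exactly; off the diagonal, the
   factor [A i j <= 0] reverses the entrywise bound. *)
have [->|neq_ij] := eqVneq i j.
  by rewrite -expr2 sqr_sqrtr// possemidef_diag_ge0.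
by rewrite ler_wnM2l ?offdiagA// possemidef_le_sqrt_diag.
Qed.

Theorem corollary4p7 (R : realType) (n m : nat)
  (Q0 : 'M[R]_n) (Q : 'I_m -> 'M[R]_n) (b : 'cV[R]_m)
  (symQ0 : Q0 \is symmetricmx)
  (symQ : forall p : 'I_m, Q p \is symmetricmx)
  (feasP : qcqp_feasible Q b !=set0)
  (hypB : assumptionB Q0 Q b)
  (offdiagQ0 : forall i j : 'I_n, i != j -> Q0 i j <= 0)
  (offdiagQ : forall (p : 'I_m) (i j : 'I_n), i != j -> Q p i j <= 0) :
  sdp_exact Q0 Q b.
Proof.
case: hypB => -[[X [[feasX psdX] minX]] _] _.
set v : 'cV[R]_n := \col_i Num.sqrt (X i i).
(* The rank is at most that of [v], which has a single column. *)
exists (v *m v^T); last exact: leq_trans (mxrankM_maxl _ _) (rank_leq_col _).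
split; first split.
- move=> p; apply: le_trans (feasX p).
  exact: frob_sqrt_diag_le (offdiagQ p) psdX.
- exact: possemidef_outer.
- move=> Z /minX; apply: le_trans.
  exact: frob_sqrt_diag_le offdiagQ0 psdX.
Qed.
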